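(* For every integer $n\ge 6$, the $3$-dimensional convex crossing number of the complete $3$-uniform hypergraph $K^3_n$ satisfies $cr^*_3(K^3_n)=3\binom{n}{6}$.
   Context: The hyperedges of $K^3_n$ are all $3$-element subsets of its $n$-element vertex set. A $3$-dimensional convex drawing of a $3$-uniform hypergraph with $n\ge 6$ vertices places the vertices at points of $\mathbb{R}^3$ that are in general position (no $4$ on a common plane) and in convex position (each point is a vertex of the convex hull of all of them), and draws each hyperedge as the $2$-simplex that is the convex hull of its three vertices. Two hyperedges form a crossing pair if they are vertex-disjoint and the corresponding simplices have a common point in their relative interiors. Pairs of hyperedges are unordered. The $3$-dimensional convex crossing number $cr^*_3(H)$ of a $3$-uniform hypergraph $H$ is the minimum number of crossing pairs of hyperedges over all $3$-dimensional convex drawings of $H$. *)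

(* Defs.v *)
From mathcomp Require Import all_boot all_order all_algebra.
From mathcomp Require Import all_classical all_reals all_analysis.
Set Implicit Arguments.
Unset Strict Implicit.
Unset Printing Implicit Defensive.

Import Order.TTheory GRing.Theory Num.Theory.
Import numFieldNormedType.Exports.

Local Open Scope classical_set_scope.
Local Open Scope ring_scope.

Record hypergraph3 (T : finType) := Hypergraph3 {
  hyperedges :> {set {set T}};
  hyperedges_uniform : forall e, e \in hyperedges -> #|e| = 3%N }.

Lemma complete3_uniform (n : nat) (e : {set 'I_n}) :
  e \in [set A : {set 'I_n} | #|A| == 3%N]%SET -> #|e| = 3%N.
Proof. by rewrite finset.inE => /eqP. Qed.

Definition complete3 (n : nat) : hypergraph3 'I_n :=
  Hypergraph3 (@complete3_uniform n).

Definition conv_hull (R : realType) (d : nat) (A : set 'rV[R]_d) :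
    set 'rV[R]_d :=
  smallest (@convex_set R 'rV[R]_d) A.

Definition affine_set (R : realType) (d : nat) (A : set 'rV[R]_d) : Prop :=
  forall (x y : 'rV[R]_d) (t : R), A x -> A y -> A (t *: x + (1 - t) *: y).

Definition affine_hull (R : realType) (d : nat) (A : set 'rV[R]_d) :
    set 'rV[R]_d :=
  smallest (@affine_set R d) A.

(* Interior of A in the subspace topology of its affine hull. The topology of
   'rV[R]_d comes from the sup norm, hence is the usual one of R^d. *)
Definition rel_interior (R : realType) (d : nat) (A : set 'rV[R]_d) :
    set 'rV[R]_d :=
  [set x | A x /\ within (affine_hull A) (nbhs x) A].

Definition dot (R : realType) (d : nat) (a x : 'rV[R]_d) : R :=
  \sum_(j < d) a 0 j * x 0 j.

Definition plane (R : realType) (P : set 'rV[R]_3) : Prop :=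
  exists (a : 'rV[R]_3) (b : R), a != 0 /\ P = [set x | dot a x = b].

(* x is a zero-dimensional face: some linear functional attains its maximum
   over C exactly at x. *)
Definition is_vertex (R : realType) (d : nat) (C : set 'rV[R]_d)
    (x : 'rV[R]_d) : Prop :=
  C x /\ exists a : 'rV[R]_d, forall y, C y -> y != x -> dot a y < dot a x.

Definition general_position (R : realType) (T : finType)
    (p : T -> 'rV[R]_3) : Prop :=
  forall A : {set T}, #|A| = 4%N ->
  ~ exists2 P : set 'rV[R]_3, plane P & forall v, v \in A -> P (p v).

Definition convex_position (R : realType) (T : finType)
    (p : T -> 'rV[R]_3) : Prop :=
  forall v, is_vertex (conv_hull (range p)) (p v).

(* Hyperedges are drawn as the simplices spanned by their vertices, so the
   placement p of the vertices determines the drawing. *)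
Definition convex_drawing (R : realType) (T : finType)
    (p : T -> 'rV[R]_3) : Prop :=
  [/\ injective p, general_position p & convex_position p].

Definition simplex (R : realType) (T : finType) (p : T -> 'rV[R]_3)
    (e : {set T}) : set 'rV[R]_3 :=
  conv_hull (p @` [set` e]).

Definition crosses (R : realType) (T : finType) (p : T -> 'rV[R]_3)
    (e f : {set T}) : Prop :=
  [disjoint e & f]%B /\
  rel_interior (simplex p e) `&` rel_interior (simplex p f) !=set0.

(* An unordered pair of hyperedges is the two-element set [set e; f]; crossing
   hyperedges are disjoint and nonempty, hence distinct. *)
Definition crossing_pairs (R : realType) (T : finType) (H : hypergraph3 T)
    (p : T -> 'rV[R]_3) : {set {set {set T}}} :=
  [set P | [exists e in hyperedges H, exists f in hyperedges H,
      (P == [set e; f]) && `[< crosses p e f >]]]%SET.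

Definition crossing_counts (R : realType) (T : finType) (H : hypergraph3 T) :
    set nat :=
  [set k | exists2 p : T -> 'rV[R]_3,
     convex_drawing p & #|crossing_pairs H p| = k].

(* Minimum of crossing_counts; the default value 0 would only be taken if H
   had no convex drawing at all. *)
Definition convex_crossing_number3 (R : realType) (T : finType)
    (H : hypergraph3 T) : nat :=
  xget 0%N [set k | crossing_counts R H k /\
                    forall j, crossing_counts R H j -> (k <= j)%N].

(* Main.v *)
Require Import Defs.
From mathcomp Require Import all_boot all_order all_algebra.
From mathcomp Require Import all_classical all_reals all_analysis.
From mathcomp Require Import ring lra.

(** Every convex drawing of the complete 3-uniform hypergraph on [n] vertices
    has the same number of crossing pairs, because each set of six vertices
    contributes exactly three of them. So the minimum is attained by any convex
    drawing, and the moment curve provides one ([convex_drawing_moment_curve]).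

    Two disjoint triangles cross iff there is an affine dependence among their
    six vertices that is positive on one triangle and negative on the other
    ([crossesP]). By general position the affine dependences among six points
    of space form a plane, and a nonzero one vanishes at most once; so they are
    the combinations [a * u + b * w] of two of them, where [w] can be chosen
    with no zero among the six points and the ratios [u i / w i] are distinct
    ([dependence_pencil]). Ordering the points by this ratio and letting [r]
    grow, the dependence [u - r * w] changes the sign of one point at a time, in
    this order. This is the rotating line through the origin of the
    two-dimensional Gale diagram. Up to global sign, the sign vectors of the
    dependences without zeros are therefore six: the k-th one, for k < 6, is
    the sign vector of [w] flipped on the first k points
    ([pencil_sign_vectors], [pencil_realises]).

    Let c k be the number of positive signs in the k-th sign vector. As the
    points are in convex position, every nonzero dependence has at least two
    positive and two negative signs ([dependence_two_positive]), so c k is 2, 3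
    or 4. As one sign is flipped at each step, c k alternates in parity. Hence
    c k = 3 for exactly three of the six values of k ([halving_stages]), and
    these three splits of the six points into two triples are the crossing pairs
    ([six_point_crossings]). *)

Set Implicit Arguments.
Unset Strict Implicit.
Unset Printing Implicit Defensive.

Import Order.TTheory GRing.Theory Num.Theory.
Import numFieldNormedType.Exports.

Local Open Scope ring_scope.

(** * Sign vectors of a pencil *)

Lemma sorted_enumeration (d : Order.disp_t) (O : orderType d) (T : finType)
    (t : T -> O) (m : nat) (S : {set T}) :
    {in S &, injective t} -> #|S| = m ->
  exists2 f : 'I_m -> T, S = [set f i | i in 'I_m]%SET &
    forall i j : 'I_m, (i < j)%N = (t (f i) < t (f j))%O.
Proof.
move=> t_inj; case: m => [|m] cardS.
  exists (fun i : 'I_0 => False_rect _ (notF (ltn_ord i))); last by case.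
  apply/setP => x; move/eqP: cardS; rewrite cards_eq0 => /eqP ->.
  by rewrite finset.in_set0; apply/esym/imsetP => -[[]].
have /card_gt0P[x0 x0S] : (0 < #|S|)%N by rewrite cardS.
pose le_t := [rel x y | (t x <= t y)%O].
have le_tr : transitive le_t by move=> y x z /=; apply: le_trans.
have le_total : total le_t by move=> x y; apply: le_total.
pose s := sort le_t (enum S).
have s_sorted : sorted le_t s by apply: sort_sorted.
have size_s : size s = m.+1 by rewrite size_sort -cardE.
have s_uniq : uniq s by rewrite sort_uniq enum_uniq.
have mem_s x : (x \in s) = (x \in S) by rewrite mem_sort mem_enum.
pose f (i : 'I_m.+1) := nth x0 s i.
have fS i : f i \in S by rewrite -mem_s mem_nth // size_s.
have f_le (i j : 'I_m.+1) : (i <= j)%N -> (t (f i) <= t (f j))%O.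
  by apply: (sorted_leq_nth le_tr _ x0 s_sorted); rewrite ?inE ?size_s //= => x /=.
have f_inj : injective f.
  move=> i j /eqP; rewrite nth_uniq ?size_s // => /eqP; exact: val_inj.
exists f.
  apply/setP => x; rewrite -mem_s; apply/idP/imsetP => [xs|[i _ ->]].
    have lt_x : (index x s < m.+1)%N by rewrite -size_s index_mem.
    by exists (Ordinal lt_x); rewrite // /f nth_index.
  by rewrite mem_s.
move=> i j; apply/idP/idP => [lt_ij|].
  rewrite lt_neqAle f_le 1?ltnW // andbT; apply/eqP => /t_inj eq_ij.
  by move: lt_ij; rewrite (f_inj _ _ (eq_ij _ _)) ?ltnn.
by apply: contraTT; rewrite -leqNgt -leNgt => /f_le.
Qed.

Lemma lower_set_prefix (R : realType) (m : nat) (t : 'I_m -> R) (r : R) :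
    (forall i j : 'I_m, (i < j)%N = (t i < t j)) ->
  exists2 k, (k <= m)%N & forall i : 'I_m, (t i < r) = (i < k)%N.
Proof.
move=> t_mono; have t_le (i j : 'I_m) : (i <= j)%N -> t i <= t j.
  by rewrite leqNgt t_mono -leNgt.
have [/forallP all_lt|] := boolP [forall i, t i < r].
  by exists m => // i; rewrite all_lt ltn_ord.
rewrite negb_forall => /existsP[i0]; rewrite -leNgt => ri0.
have [k rk k_min] := @arg_minnP _ i0 (fun i => r <= t i) (@nat_of_ord m) ri0.
exists k => [|i]; first exact: ltnW.
apply/idP/idP; last by rewrite ltNge; apply: contraL => /k_min; rewrite -leqNgt.
by apply: contraTT; rewrite -leqNgt -leNgt => /t_le; apply: le_trans.
Qed.

Lemma prefix_threshold (R : realType) (m : nat) (t : 'I_m -> R) (k : 'I_m) :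
    (forall i j : 'I_m, (i < j)%N = (t i < t j)) ->
  exists r, forall i : 'I_m, t i != r /\ (t i < r) = (i < k)%N.
Proof.
move=> t_mono; have t_le (i j : 'I_m) : (i <= j)%N -> t i <= t j.
  by rewrite leqNgt t_mono -leNgt.
suff [r rk lt_r] : exists2 r, r < t k & forall i : 'I_m, (i < k)%N -> t i < r.
  exists r => i; have [/lt_r ltir|/t_le leki] := ltnP i k.
    by rewrite (lt_eqF ltir) ltir.
  by have ltri := lt_le_trans rk leki; rewrite (gt_eqF ltri) ltNge (ltW ltri).
have [k0|] := posnP k.
  by exists (t k - 1); [lra | move=> i; rewrite k0].
move=> k_gt0; have lt_k1 : (k.-1 < m)%N by rewrite (leq_ltn_trans (leq_pred k)).
have lt_t : t (Ordinal lt_k1) < t k by rewrite -t_mono /= prednK.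
exists ((t (Ordinal lt_k1) + t k) / 2); first lra.
move=> i ltik; have /t_le : (i <= Ordinal lt_k1)%N by rewrite -ltnS /= prednK.
lra.
Qed.

(** If [s] is the sign vector of [w], this is the set of positive indices of
    [u - r * w] when exactly [k] ratios [u i / w i] lie below [r]. *)
Definition flip_prefix (m : nat) (s : 'I_m -> bool) (k : nat) : {set 'I_m} :=
  [set i | s i (+) (i < k)%N]%SET.

(** When [a] is nonzero, [a * u + b * w] is the product of [a], of [w] and of the
    ratio [u i / w i] minus a constant, so its sign is that of [w] flipped on an
    initial segment, up to the sign of [a]. The segment of all [m] indices gives
    the complement of the empty one, which leaves [m] stages. *)
Lemma pencil_sign_vectors (R : realType) (m : nat) (u w : 'I_m -> R) (a b : R) :
    (0 < m)%N -> (forall i, w i != 0) ->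
    (forall i j : 'I_m, (i < j)%N = (u i / w i < u j / w j)) ->
    (forall i, a * u i + b * w i != 0) ->
  let pos := [set i | 0 < a * u i + b * w i]%SET in
  let P := flip_prefix (fun i => 0 < w i) in
  exists k : 'I_m, pos = P k \/ pos = ~: P k.
Proof.
move=> m_gt0 w_neq0 mono v_neq0 pos P.
have P_all : P m = ~: P 0%N.
  by apply/setP => i; rewrite !finset.inE ltn_ord addbT addbF.
suff [k le_km pos_k] : exists2 k, (k <= m)%N & pos = P k \/ pos = ~: P k.
  move: le_km; rewrite leq_eqVlt => /orP[/eqP km|lt_km]; last first.
    by exists (Ordinal lt_km).
  exists (Ordinal m_gt0); case: pos_k => ->; rewrite km P_all ?finset.setCK;
  by [right|left].
have [a0|a_neq0] := eqVneq a 0.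
  exists 0%N => //; have b_neq0 : b != 0.
    by move: (v_neq0 (Ordinal m_gt0)); rewrite a0 mul0r add0r mulf_eq0 => /norP[].
  have [b_gt0|b_le0] := ltP 0 b; [left|right]; apply/setP => i;
    rewrite !finset.inE a0 mul0r add0r addbF; first by rewrite pmulr_rgt0.
  have b_lt0 : b < 0 by rewrite lt_neqAle b_neq0.
  by rewrite nmulr_rgt0 // -leNgt lt_neqAle w_neq0.
have [k le_km lt_k] := lower_set_prefix (- b / a) mono.
have v_neq i : u i / w i != - b / a.
  apply: contra_neq (v_neq0 i) => /eqP.
  by rewrite eqr_div // => /eqP; lra.
exists k => //.
have posE i : (0 < a * u i + b * w i) = (0 < a) (+) ~~ ((0 < w i) (+) (i < k)%N).
  have -> : a * u i + b * w i = a * (w i * (u i / w i - (- b / a))).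
    by field; rewrite a_neq0 w_neq0.
  rewrite -lt_k; set t := u i / w i; set r := - b / a.
  have tr : (t < r) = ~~ (0 < t - r).
    by rewrite subr_gt0 -leNgt lt_neqAle v_neq.
  have d_neq0 : t - r != 0 by rewrite subr_eq0 v_neq.
  have nposE (x : R) : x != 0 -> ~~ (0 < x) -> x < 0.
    by move=> x0; rewrite -leNgt lt_neqAle x0.
  have pM (x y : R) : x != 0 -> y != 0 -> (0 < x * y) = (0 < x) (+) ~~ (0 < y).
    move=> x0 y0; have [x_gt0|x_lt0] := boolP (0 < x).
      by rewrite pmulr_rgt0 //= negbK.
    by rewrite (nmulr_rgt0 _ (nposE _ x0 x_lt0)) /= -leNgt lt_neqAle y0.
  by rewrite pM ?mulf_neq0 // pM // tr; do 3 case: (_ < _).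
by case a_gt0: (0 < a); [left|right]; apply/setP => i;
  rewrite !finset.inE posE a_gt0 /= ?negbK.
Qed.

Lemma pencil_realises (R : realType) (m : nat) (u w : 'I_m -> R) (k : 'I_m) :
    (forall i, w i != 0) ->
    (forall i j : 'I_m, (i < j)%N = (u i / w i < u j / w j)) ->
  exists r : R, forall i, u i - r * w i != 0 /\
    (i \in flip_prefix (fun i => 0 < w i) k) = (0 < u i - r * w i).
Proof.
move=> w_neq0 mono; have [r r_k] := prefix_threshold k mono.
exists r => i; have [tr lt_r] := r_k i.
have -> : u i - r * w i = w i * (u i / w i - r) by field.
rewrite mulf_neq0 ?subr_eq0 // finset.inE -lt_r; split => //.
have [w_gt0|] := ltP 0 (w i).
  by rewrite pmulr_rgt0 // subr_gt0 ltNge lt_neqAle eq_sym tr /= -ltNge ltNge; case: (_ <= _).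
move=> w_le0; rewrite nmulr_rgt0 ?subr_lt0 //.
by rewrite lt_neqAle w_neq0.
Qed.

Lemma odd_card_set (m : nat) (A : {set 'I_m}) :
  odd #|A| = \big[addb/false]_(i < m) (i \in A).
Proof.
rewrite -sum1_card big_mkcond (big_morph odd oddD (erefl (odd 0))).
by apply: eq_bigr => i _; case: ifP.
Qed.

Lemma odd_flip_prefix (m : nat) (s : 'I_m -> bool) (k : 'I_m) :
  odd #|flip_prefix s k| = odd #|flip_prefix s 0| (+) odd k.
Proof.
rewrite !odd_card_set.
have -> : odd k = \big[addb/false]_(i < m) (i < k)%N.
  have widen_inj : injective (widen_ord (ltnW (ltn_ord k))).
    by move=> i j /(congr1 val) /= eq_ij; apply: val_inj.
  rewrite -[in LHS](card_ord k) -(card_imset _ widen_inj).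
  rewrite odd_card_set; apply: eq_bigr => i _; apply/imsetP/idP => [[j _ ->]|lt_ik].
    exact: ltn_ord j.
  by exists (Ordinal lt_ik) => //; apply: val_inj.
rewrite -big_split; apply: eq_bigr => i _.
by rewrite !finset.inE /= addbF.
Qed.

(** The sizes lie between 2 and 4 and alternate in parity, so they are 3 at all
    the even stages or at all the odd ones. *)
Lemma halving_stages (s : 'I_6 -> bool) :
    (forall k : 'I_6, 2 <= #|flip_prefix s k| <= 4)%N ->
  #|[set k : 'I_6 | #|flip_prefix s k| == 3%N]%SET| = 3%N.
Proof.
move=> bounds.
have halfE (k : 'I_6) :
    (#|flip_prefix s k| == 3%N) = odd #|flip_prefix s 0| (+) odd k.
  by rewrite -odd_flip_prefix; move: (bounds k); case: #|_| => [|[|[|[|[|]]]]].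
rewrite -sum1_card big_mkcond.
under eq_bigr do rewrite finset.inE halfE.
by case: (odd _); rewrite !big_ord_recl big_ord0.
Qed.

(** The index [k] separates stage [k] from any later stage [l], while the last
    index is flipped in no stage, so that distinct stages are not complementary
    either. *)
Lemma flip_prefix_inj (m : nat) (s : 'I_m -> bool) (k l : 'I_m) :
    flip_prefix s k = flip_prefix s l \/ flip_prefix s k = ~: flip_prefix s l ->
  k = l.
Proof.
wlog lt_kl : k l / (k < l)%N => [hw|].
  have [/hw|/hw|eq_kl _] := ltngtP k l; last exact: val_inj.
    exact.
  move=> hlk [] E; apply/esym/hlk; rewrite E; first by left.
  by right; rewrite finset.setCK.
have lt_m1 : (m.-1 < m)%N by rewrite prednK // (leq_ltn_trans (leq0n k)).
have le_m1 (j : 'I_m) : (Ordinal lt_m1 < j)%N = false.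
  by rewrite ltnNge -ltnS prednK ?ltn_ord // (leq_ltn_trans (leq0n k)).
case=> /setP E.
  by move: (E k); rewrite !finset.inE ltnn lt_kl; case: (s k).
by move: (E (Ordinal lt_m1)); rewrite !finset.inE !le_m1; case: (s _).
Qed.

(** * Barycentric coordinates *)

(** In homogeneous coordinates, affine combinations and affine dependences
    become linear ones. *)
Definition homog (R : realType) (d : nat) (x : 'rV[R]_d) : 'rV[R]_(d + 1) :=
  row_mx x (const_mx 1).

Lemma homog_comb (R : realType) (d : nat) (t : R) (x y : 'rV[R]_d) :
  homog (t *: x + (1 - t) *: y) = t *: homog x + (1 - t) *: homog y.
Proof.
rewrite /homog !scale_row_mx add_row_mx -scalerDl.
by rewrite [t + _]addrC subrK scale1r.
Qed.

Lemma sum_homog (R : realType) (d : nat) (T : finType) (A : {pred T})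
    (l : T -> R) (p : T -> 'rV[R]_d) :
  \sum_(i in A) l i *: homog (p i) =
  row_mx (\sum_(i in A) l i *: p i) (const_mx (\sum_(i in A) l i)).
Proof.
apply: (@big_ind3 _ _ _ (fun a b c => a = row_mx b (const_mx c))).
- by apply/matrixP => i j; rewrite !mxE; case: splitP => k _; rewrite !mxE.
- move=> _ a' a'' _ b' b'' -> ->; rewrite add_row_mx; congr row_mx.
  by apply/matrixP => i j; rewrite !mxE.
move=> i _; rewrite scale_row_mx; congr row_mx.
by apply/matrixP => k j; rewrite !mxE mulr1.
Qed.

Definition affine_form (R : realType) (d : nat) (c : 'cV[R]_(d + 1))
    (x : 'rV[R]_d) : R :=
  (homog x *m c) 0 0.

Lemma affine_formE (R : realType) (d : nat) (c : 'cV[R]_(d + 1)) (x : 'rV[R]_d) :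
  affine_form c x = dot (usubmx c)^T x + dsubmx c 0 0.
Proof.
rewrite /affine_form /homog -{1}(vsubmxK c) mul_row_col mxE.
congr (_ + _); rewrite mxE; last by rewrite big_ord1 mxE mul1r.
by apply: eq_bigr => j _; rewrite !mxE mulrC.
Qed.

Lemma affine_form_comb (R : realType) (d : nat) (c : 'cV[R]_(d + 1)) (t : R) x y :
  affine_form c (t *: x + (1 - t) *: y) =
  t * affine_form c x + (1 - t) * affine_form c y.
Proof. by rewrite /affine_form homog_comb mulmxDl -!scalemxAl !mxE. Qed.

Lemma affine_form_col (R : realType) (d m : nat) (B : 'M[R]_(d + 1, m))
    (j : 'I_m) (x : 'rV[R]_d) :
  affine_form (col j B) x = (homog x *m B) 0 j.
Proof.
rewrite /affine_form [LHS]mxE [RHS]mxE; apply: eq_bigr => i _; congr (_ * _).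
by rewrite mxE.
Qed.

Lemma continuous_dot (R : realType) (d : nat) (a : 'rV[R]_d) :
  continuous (dot a).
Proof.
apply: continuous_big => [|j _ x]; first exact: add_continuous.
apply: (continuousM (@cst_continuous _ _ (a 0 j) x)).
exact: (@coord_continuous _ _ _ 0 j).
Qed.

Lemma continuous_affine_form (R : realType) (d : nat) (c : 'cV[R]_(d + 1)) :
  continuous (affine_form c).
Proof.
have -> : affine_form c = (fun x => dot (usubmx c)^T x + dsubmx c 0 0).
  by apply/funext => x; rewrite affine_formE.
move=> x; apply: continuousD; [exact: continuous_dot | exact: cst_continuous].
Qed.

(** The homogeneous coordinates of four points that lie on no common plane form
    a basis of 4-space: a column orthogonal to all of them would be the equation
    of a plane. The dual basis gives their barycentric coordinates. *)
Lemma dual_basis (R : realType) (T : finType) (p : T -> 'rV[R]_3)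
    (A : {set T}) : general_position p -> #|A| = 4%N ->
  exists c : T -> 'cV[R]_(3 + 1),
    (forall x, homog x = \sum_(i in A) affine_form (c i) x *: homog (p i)) /\
    {in A &, forall i j, affine_form (c j) (p i) = (i == j)%:R}.
Proof.
move=> gp cardA.
have [||f def_A _] := @sorted_enumeration _ nat _ (fun x => enum_rank x : nat) 4 A.
- by move=> x y _ _ /= /ord_inj /enum_rank_inj.
- by [].
have f_inj : injective f.
  have /imset_injP f_inj : #|[set f i | i in 'I_4]%SET| == #|'I_4|.
    by rewrite -def_A cardA card_ord.
  by move=> i j; apply: f_inj.
have fA i : f i \in A by rewrite def_A imset_f.
pose M : 'M[R]_(3 + 1) := \matrix_i homog (p (f i)).
have unitM : M \in unitmx.
  rewrite -unitmx_tr -row_free_unit -kermx_eq0; apply/eqP.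
  apply/row_matrixP => k; rewrite row0; apply/eqP/negP => /negP c_neq0.
  set r := row k _ in c_neq0; have rM : r *m M^T = 0.
    by apply/sub_kermxP; rewrite row_sub.
  have f0 i : affine_form r^T (p (f i)) = 0.
    have /matrixP/(_ i 0) : M *m r^T = 0 by rewrite -[M]trmxK -trmx_mul rM trmx0.
    rewrite [RHS]mxE => <-; rewrite /affine_form [LHS]mxE [RHS]mxE.
    by apply: eq_bigr => j _; congr (_ * _); rewrite [RHS]mxE.
  (* The first three entries of [r] form a normal vector, the last a constant. *)
  pose a := (usubmx r^T)^T; have aE i : dot a (p (f i)) = - dsubmx r^T 0 0.
    by apply/eqP; rewrite -addr_eq0 -affine_formE f0.
  case: (gp A cardA); exists [set x | dot a x = - dsubmx r^T 0 0]%classic.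
    exists a, (- dsubmx r^T 0 0); split => //; apply: contraNneq c_neq0 => a0.
    move: (aE 0); rewrite a0 /dot big1 => [/esym/eqP|j _]; last by rewrite mxE mul0r.
    rewrite oppr_eq0 => /eqP d0.
    rewrite -[r]trmxK -[r^T]vsubmxK -[usubmx _]trmxK -/a a0 trmx0.
    have -> : dsubmx r^T = 0 by apply/matrixP => i j; rewrite !ord1 d0 mxE.
    by rewrite col_mx0 trmx0.
  by move=> v; rewrite def_A => /imsetP[i _ ->].
pose g x := odflt 0 [pick i | f i == x].
have gK : cancel f g.
  move=> i; rewrite /g; case: pickP => [j /eqP/f_inj //|/(_ i)].
  by rewrite eqxx.
exists (fun x => col (g x) (invmx M)); split.
  move=> x; rewrite def_A big_imset /=; last by move=> ? ? _ _; apply: f_inj.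
  rewrite -[LHS]mulmx1 -(mulVmx unitM) mulmxA mulmx_sum_row.
  apply: eq_bigr => i _; rewrite gK rowK; congr (_ *: _).
  by rewrite affine_form_col.
move=> x y; rewrite def_A => /imsetP[i _ ->] /imsetP[j _ ->].
rewrite gK (inj_eq f_inj) affine_form_col.
have /matrixP/(_ i j) := mulmxV unitM; rewrite [RHS]mxE => <-.
rewrite [LHS]mxE [RHS]mxE; apply: eq_bigr => k _; congr (_ * _).
by rewrite [RHS]mxE.
Qed.

(** * Relative interiors and crossings *)

Lemma convex_setP (R : realType) (d : nat) (C : set 'rV[R]_d) :
  convex_set C <->
  (forall t x y, 0 <= t <= 1 -> C x -> C y -> C (t *: x + (1 - t) *: y)).
Proof.
split=> [cC t x y /andP[t0 t1] Cx Cy | cC x y t].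
  by have := cC x y (Itv01 t0 t1) (mem_set Cx) (mem_set Cy); rewrite in_setE.
rewrite !in_setE => Cx Cy; apply: cC => //.
by apply/andP; split.
Qed.

Lemma convex_combination (R : realType) (d : nat) (C : set 'rV[R]_d)
    (I : eqType) (s : seq I) (l : I -> R) (q : I -> 'rV[R]_d) :
    convex_set C -> {in s, forall i, C (q i)} -> {in s, forall i, 0 <= l i} ->
    \sum_(i <- s) l i = 1 ->
  C (\sum_(i <- s) l i *: q i).
Proof.
move=> /convex_setP cC; elim: s l => [|a s IHs] l Cq l_ge0.
  by rewrite big_nil => /eqP; rewrite eq_sym oner_eq0.
rewrite !big_cons => sum1; set S := \sum_(j <- s) l j in sum1.
have S_ge0 : 0 <= S.
  by rewrite /S big_seq sumr_ge0 // => i si; rewrite l_ge0 // inE si orbT.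
have la_ge0 : 0 <= l a by rewrite l_ge0 ?mem_head.
have Ca : C (q a) by apply: Cq; rewrite mem_head.
have [S0|S_neq0] := eqVneq S 0.
  have ls0 i : i \in s -> l i = 0.
    move=> si; apply/eqP; move/eqP: S0; rewrite /S big_seq psumr_eq0.
      by move=> /allP/(_ i si); rewrite si.
    by move=> j sj; rewrite l_ge0 // inE sj orbT.
  rewrite big_seq big1 => [|i si]; last by rewrite ls0 ?scale0r.
  by move: sum1; rewrite S0 !addr0 => ->; rewrite scale1r.
have -> : \sum_(j <- s) l j *: q j = S *: \sum_(j <- s) (l j / S) *: q j.
  rewrite scaler_sumr; apply: eq_bigr => i _.
  by rewrite scalerA mulrCA mulfV // mulr1.
have -> : S = 1 - l a by rewrite -sum1 addrC addKr.
apply: cC => //; first by rewrite la_ge0 -sum1 lerDl.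
have -> : 1 - l a = S by rewrite -sum1 addrC addKr.
apply: IHs.
- by move=> i si; apply: Cq; rewrite inE si orbT.
- by move=> i si; rewrite divr_ge0 // l_ge0 // inE si orbT.
by rewrite -mulr_suml mulfV.
Qed.

(** The triangle on [e] is studied in the barycentric coordinates of a
    tetrahedron [v |: e]: the affine hull of the triangle satisfies
    [coord v x = 0], the triangle is cut out of it by the signs of the other
    coordinates, and continuity of the coordinates identifies the relative
    interior. *)
Section Coordinates.
Variables (R : realType) (T : finType) (p : T -> 'rV[R]_3).
Variables (e : {set T}) (v : T) (c : T -> 'cV[R]_(3 + 1)).
Hypothesis ve : v \notin e.
Hypothesis homogE : forall x,
  homog x = \sum_(i in v |: e) affine_form (c i) x *: homog (p i).
Hypothesis c_dual :
  {in v |: e &, forall i j, affine_form (c j) (p i) = (i == j)%:R}.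

Let coord i x := affine_form (c i) x.

Let in_e i : i \in e -> i \in v |: e.
Proof. by move=> ie; rewrite in_setU1 ie orbT. Qed.

Let coord_p i j : i \in e -> j \in e -> coord j (p i) = (i == j)%:R.
Proof. by move=> ie je; rewrite /coord (c_dual (in_e ie) (in_e je)). Qed.

Let coord_v i : i \in e -> coord v (p i) = 0.
Proof.
move=> ie; rewrite /coord (c_dual (in_e ie) (finset.setU11 _ _)).
by case: eqP => // iv; move: ve; rewrite -iv ie.
Qed.

Lemma homog_on_face x : coord v x = 0 ->
  homog x = \sum_(i in e) coord i x *: homog (p i).
Proof.
move=> xv; rewrite {1}homogE big_setU1 //=.
by rewrite -[affine_form (c v) x]/(coord v x) xv scale0r add0r.
Qed.

Lemma face_coord_sum x : coord v x = 0 ->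
  x = \sum_(i in e) coord i x *: p i /\ \sum_(i in e) coord i x = 1.
Proof.
move=> /homog_on_face; rewrite sum_homog => /eq_row_mx[xE /matrixP/(_ 0 0)].
by rewrite !mxE => sum1.
Qed.

Lemma simplex_coord x :
  simplex p e x <-> coord v x = 0 /\ {in e, forall i, 0 <= coord i x}.
Proof.
split; last first.
  move=> [/face_coord_sum[xE sum1] x_ge0] C [cC eC]; rewrite xE -big_enum /=.
  apply: convex_combination => //.
  - by move=> i; rewrite mem_enum => ie; apply: eC; exists i.
  - by move=> i; rewrite mem_enum; apply: x_ge0.
  by rewrite big_enum.
move: x; apply: smallest_sub.
  apply/convex_setP => t x y /andP[t0 t1] [xv x0] [yv y0]; split.
    by rewrite /coord affine_form_comb -!/(coord _ _) xv yv !mulr0 addr0.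
  move=> i ie; rewrite /coord affine_form_comb addr_ge0 ?mulr_ge0 ?x0 ?y0 //.
  by rewrite subr_ge0.
move=> _ [i /= ie <-]; split; first exact: coord_v.
by move=> j je; rewrite coord_p.
Qed.

Lemma affine_hull_coord x : affine_hull (simplex p e) x -> coord v x = 0.
Proof.
move: x; apply: smallest_sub => [x y t /= xv yv|x /simplex_coord[]//].
by rewrite /coord affine_form_comb -!/(coord _ _) xv yv !mulr0 addr0.
Qed.

(** If a coordinate of [x] vanishes at the vertex [i], moving slightly from [x]
    away from [p i] stays in the affine hull but leaves the triangle. *)
Lemma rel_interior_coord x :
  rel_interior (simplex p e) x <->
  coord v x = 0 /\ {in e, forall i, 0 < coord i x}.
Proof.
split=> [[xs x_int]|[xv x_gt0]].
  have /simplex_coord[xv x_ge0] := xs; split=> // i ie.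
  rewrite lt_neqAle x_ge0 // andbT; apply/eqP => /esym xi0.
  have /nbhs_normP[eps /= eps_gt0 eps_near] := x_int.
  (* Small enough for [s * `|x - p i| < eps]. *)
  pose s := eps / 2 / (1 + `|x - p i|).
  have D_gt0 : 0 < 1 + `|x - p i| by rewrite ltr_pwDl.
  have s_gt0 : 0 < s by rewrite !divr_gt0.
  pose y := (1 + s) *: x + (1 - (1 + s)) *: p i.
  have pi_s : simplex p e (p i).
    by move=> C [_]; apply; exists i.
  have y_hull : affine_hull (simplex p e) y.
    by move=> C [aC sC]; apply: aC; apply: sC.
  have /simplex_coord[_ /(_ i ie)] : simplex p e y.
    apply: eps_near => //=.
    have -> : x - y = - s *: (x - p i).
      by apply/matrixP => a b; rewrite !mxE; ring.
    rewrite normrZ normrN gtr0_norm //.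
    have sD : s * (1 + `|x - p i|) = eps / 2 by rewrite mulfVK ?gt_eqF.
    lra.
  rewrite leNgt /coord affine_form_comb -!/(coord _ _) xi0 coord_p // eqxx.
  by rewrite mulr0 add0r mulr1 opprD addNKr oppr_lt0 s_gt0.
split; first by apply/simplex_coord; split=> // i /x_gt0/ltW.
have near_gt0 : nbhs x [set y | forall i, i \in e -> 0 < coord i y]%classic.
  apply: (@filter_forall _ _ (fun i y => i \in e -> 0 < coord i y) _
    (nbhs_filter x)) => i.
  have [ie|_] := boolP (i \in e); last by apply: nearW.
  have gt0_nbhs := lt_nbhsr (x_gt0 i ie).
  have := @continuous_affine_form _ _ (c i) x _ gt0_nbhs.
  by apply: (@filterS _ _ (nbhs_filter x)) => y.
apply: (@filterS _ _ (nbhs_filter x)) near_gt0 => y y_gt0 /affine_hull_coord yv.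
by apply/simplex_coord; split=> // i ie; apply/ltW/y_gt0.
Qed.

End Coordinates.

(** The fourth vertex [v] only completes [e] to a tetrahedron, whose coordinates
    show that the weights [l] are unique. *)
Lemma rel_interior_simplex (R : realType) (T : finType) (p : T -> 'rV[R]_3)
    (e : {set T}) (v : T) (x : 'rV[R]_3) :
    general_position p -> #|e| = 3%N -> v \notin e ->
  rel_interior (simplex p e) x <->
  exists l : T -> R, {in e, forall i, 0 < l i} /\
    homog x = \sum_(i in e) l i *: homog (p i).
Proof.
move=> gp card_e ve; have [|c [homogE c_dual]] := dual_basis (A := v |: e) gp.
  by rewrite cardsU1 ve card_e.
split=> [/(rel_interior_coord ve homogE c_dual)[xv x_gt0]|[l [l_gt0 xE]]].
  by exists (fun i => affine_form (c i) x); split=> //; apply: homog_on_face homogE _ xv.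
have coordE j : affine_form (c j) x = \sum_(i in e) l i * affine_form (c j) (p i).
  rewrite {1}/affine_form xE mulmx_suml summxE; apply: eq_bigr => i _.
  by rewrite -scalemxAl mxE.
have in_e i : i \in e -> i \in v |: e by rewrite finset.in_setU1 orbC => ->.
apply/(rel_interior_coord ve homogE c_dual); split.
  rewrite coordE big1 // => i ie.
  rewrite (c_dual _ _ (in_e i ie) (finset.setU11 _ _)).
  by case: eqP => [iv|_]; [move: ve; rewrite -iv ie | rewrite mulr0].
move=> j je; rewrite coordE (bigD1 j) //= big1 => [|i /andP[ie ij]].
  by rewrite (c_dual _ _ (in_e j je) (in_e j je)) eqxx mulr1 addr0 l_gt0.
by rewrite (c_dual _ _ (in_e i ie) (in_e j je)) (negbTE ij) mulr0.
Qed.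

Definition affine_dependence (R : realType) (T : finType) (p : T -> 'rV[R]_3)
    (l : T -> R) : Prop :=
  \sum_i l i *: homog (p i) = 0.

Lemma affine_dependence_lin (R : realType) (T : finType) (p : T -> 'rV[R]_3)
    (a b : R) (l m : T -> R) :
  affine_dependence p l -> affine_dependence p m ->
  affine_dependence p (fun i => a * l i + b * m i).
Proof.
move=> l_dep m_dep; rewrite /affine_dependence.
under eq_bigr do rewrite scalerDl -!scalerA.
by rewrite big_split /= -!scaler_sumr l_dep m_dep !scaler0 addr0.
Qed.

Lemma affine_dependence_form (R : realType) (T : finType) (p : T -> 'rV[R]_3)
    (l : T -> R) (c : 'cV[R]_(3 + 1)) :
  affine_dependence p l -> \sum_i l i * affine_form c (p i) = 0.
Proof.
move=> l_dep; transitivity (((\sum_i l i *: homog (p i)) *m c) 0 0).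
  rewrite mulmx_suml summxE; apply: eq_bigr => i _.
  by rewrite -scalemxAl [RHS]mxE.
by rewrite l_dep mul0mx mxE.
Qed.

(** Subtracting two positive representations of a common point gives a
    dependence with the required signs. Conversely, the positive and the
    negative part of such a dependence have the same total weight, and dividing
    by it gives a common point. *)
Lemma crossesP (R : realType) (T : finType) (p : T -> 'rV[R]_3)
    (e f : {set T}) : general_position p -> #|e| = 3%N -> #|f| = 3%N ->
  crosses p e f <-> [disjoint e & f]%B /\
    exists l : T -> R, [/\ affine_dependence p l, {in e, forall i, 0 < l i},
      {in f, forall i, l i < 0} & forall i, i \notin e :|: f -> l i = 0].
Proof.
move=> gp card_e card_f; rewrite /crosses.
have [dis|] := boolP [disjoint e & f]%B; last by move=> ndis; split=> -[].
have ef i : i \in e -> i \notin f by move=> ie; rewrite (disjointFr dis ie).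
have [v vf] : exists v, v \in f by apply/card_gt0P; rewrite card_f.
have [w we] : exists w, w \in e by apply/card_gt0P; rewrite card_e.
have ve : v \notin e by apply/negP => /ef; rewrite vf.
have wf : w \notin f by apply: contraL we => wf; apply/negP => /ef; rewrite wf.
have splitE (F : T -> 'rV[R]_(3 + 1)) : (forall i, i \notin e :|: f -> F i = 0) ->
    \sum_i F i = \sum_(i in e) F i + \sum_(i in f) F i.
  move=> F0; rewrite -bigU // [LHS](bigID [in e :|: f]) /=.
  rewrite [X in _ + X]big1 ?addr0 //; by apply: eq_bigl => i; rewrite !finset.inE.
split=> [[_ [x [/(rel_interior_simplex _ gp card_e ve)[l [l_gt0 xl]]]]]|].
  move=> /(rel_interior_simplex _ gp card_f wf)[m [m_gt0 xm]]; split=> //.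
  exists (fun i => if i \in e then l i else if i \in f then - m i else 0).
  have f_e i : i \in f -> (i \in e) = false.
    by move=> i_f; apply/negbTE/negP => /ef; rewrite i_f.
  split.
  - rewrite /affine_dependence splitE => [|i]; last first.
      by rewrite finset.in_setU => /norP[/negbTE-> /negbTE->]; rewrite scale0r.
    apply/eqP; rewrite addr_eq0 -sumrN; apply/eqP.
    rewrite (eq_bigr (fun i => l i *: homog (p i))) => [|i ->//].
    rewrite -xl xm; apply: eq_bigr => i i_f.
    by rewrite f_e // i_f scaleNr opprK.
  - by move=> i ie; rewrite ie l_gt0.
  - by move=> i i_f; rewrite f_e // i_f oppr_lt0 m_gt0.
  - by move=> i; rewrite finset.in_setU => /norP[/negbTE-> /negbTE->].
move=> [_ [l [l_dep l_pos l_neg l0]]]; split=> //.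
pose s := \sum_(i in e) l i.
have s_gt0 : 0 < s.
  rewrite /s (bigD1 w) //= ltr_pwDl ?l_pos // sumr_ge0 // => i /andP[ie _].
  by rewrite ltW ?l_pos.
pose x := \sum_(i in e) (l i / s) *: p i.
have xE : homog x = \sum_(i in e) (l i / s) *: homog (p i).
  by rewrite sum_homog -mulr_suml mulfV ?gt_eqF.
exists x; split.
  apply/(rel_interior_simplex x gp card_e ve).
  by exists (fun i => l i / s); split=> // i ie; rewrite divr_gt0 ?l_pos.
apply/(rel_interior_simplex x gp card_f wf).
exists (fun i => - l i / s); split=> [i i_f|].
  by rewrite divr_gt0 ?oppr_gt0 ?l_neg.
have : \sum_i (l i / s) *: homog (p i) = 0.
  under eq_bigr do rewrite mulrC -scalerA.
  by rewrite -scaler_sumr l_dep scaler0.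
rewrite splitE => [|i /l0 ->]; last by rewrite mul0r scale0r.
rewrite -xE => /eqP; rewrite addr_eq0 => /eqP ->; rewrite -sumrN.
by apply: eq_bigr => i _; rewrite mulNr scaleNr.
Qed.

(** * The dependences among six points *)

(** Such a dependence lives on four points, which are affinely independent. *)
Lemma dependence_two_zeros (R : realType) (T : finType) (p : T -> 'rV[R]_3)
    (S : {set T}) (x y : T) (l : T -> R) :
    general_position p -> #|S| = 6%N -> x \in S -> y \in S -> x != y ->
    affine_dependence p l -> (forall i, i \notin S -> l i = 0) ->
    l x = 0 -> l y = 0 ->
  forall i, l i = 0.
Proof.
move=> gp cardS xS yS xy l_dep l_supp lx ly.
pose A := S :\ x :\ y.
have cardA : #|A| = 4%N.
  move: cardS; rewrite (cardsD1 x) xS (cardsD1 y) finset.in_setD1 yS eq_sym xy.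
  by rewrite !add1n => -[].
have lA i : i \notin A -> l i = 0.
  rewrite !finset.inE !negb_and !negbK => /orP[/eqP->//|/orP[/eqP->//|]].
  exact: l_supp.
have [c [_ c_dual]] := dual_basis gp cardA.
move=> j; have [jA|/lA//] := boolP (j \in A).
have := affine_dependence_form (c j) l_dep.
rewrite (bigD1 j) //= big1 => [|i ij].
  by rewrite addr0 c_dual // eqxx mulr1.
have [iA|/lA->] := boolP (i \in A); last by rewrite mul0r.
by rewrite c_dual // (negbTE ij) mulr0.
Qed.

(** For two points [x] and [y] of [S], expressing each of them by the remaining
    four points gives dependences [D x] and [D y], and subtracting
    [l x * D x + l y * D y] from a dependence [l] on [S] makes it vanish at [x]
    and [y], hence everywhere. If two ratios [u i / w i] were equal to [r], then
    [u - r * w] would have two zeros. *)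
Lemma dependence_pencil (R : realType) (T : finType) (p : T -> 'rV[R]_3)
    (S : {set T}) : general_position p -> #|S| = 6%N ->
  exists u w : T -> R, 
  [/\ affine_dependence p u /\ affine_dependence p w,
      forall i, i \notin S -> u i = 0 /\ w i = 0,
      {in S, forall i, w i != 0},
      {in S &, injective (fun i => u i / w i)} &
      forall l, affine_dependence p l -> (forall i, i \notin S -> l i = 0) ->
        exists a b, forall i, l i = a * u i + b * w i].
Proof.
move=> gp cardS.
have [x xS] : exists x, x \in S by apply/card_gt0P; rewrite cardS.
have [y] : exists y, y \in S :\ x.
  by apply/card_gt0P; move: cardS; rewrite (cardsD1 x) xS add1n => -[->].
rewrite finset.in_setD1 => /andP[yx yS].
have xy : x != y by rewrite eq_sym.
have two_zeros := dependence_two_zeros gp cardS xS yS xy.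
pose A := S :\ x :\ y.
have cardA : #|A| = 4%N.
  move: cardS; rewrite (cardsD1 x) xS (cardsD1 y) finset.in_setD1 yS yx.
  by rewrite !add1n => -[].
have [c [homogE _]] := dual_basis gp cardA.
have xA : x \notin A by rewrite !finset.inE eqxx andbF.
have yA : y \notin A by rewrite !finset.inE eqxx.
pose D z i := if i == z then 1 else if i \in A then - affine_form (c i) (p z) else 0.
have D_dep z : z \notin A -> affine_dependence p (D z).
  move=> zA; rewrite /affine_dependence (bigD1 z) //= {1}/D eqxx scale1r.
  rewrite (bigID [in A]) /= [X in _ + (_ + X)]big1 => [|i /andP[iz iA]]; last first.
    by rewrite /D (negbTE iz) (negbTE iA) scale0r.
  rewrite addr0 {1}homogE; apply/eqP; rewrite addr_eq0 -sumrN; apply/eqP.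
  rewrite [RHS](eq_bigl [in A]) => [|i]; last first.
    by case: eqP => //= ->; rewrite (negbTE zA).
  apply: eq_bigr => i iA; rewrite /D iA.
  by case: eqP iA zA => [-> ->|_ _ _] //; rewrite scaleNr opprK.
have D_supp z : z \in S -> forall i, i \notin S -> D z i = 0.
  move=> zS i iS; rewrite /D; case: eqP iS => [->|_ iS]; first by rewrite zS.
  by rewrite !finset.inE (negbTE iS) !andbF.
have Dxx : D x x = 1 by rewrite /D eqxx.
have Dyy : D y y = 1 by rewrite /D eqxx.
have Dxy : D x y = 0 by rewrite /D (negbTE yx) (negbTE yA).
have Dyx : D y x = 0 by rewrite /D (negbTE xy) (negbTE xA).
have Dx_neq0 i : i \in A -> D x i != 0.
  move=> iA; apply/eqP => Dxi.
  have iS : i \in S by move: iA; rewrite !finset.inE => /and3P[].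
  have iy : i != y by move: iA; rewrite !finset.inE => /and3P[].
  have := dependence_two_zeros gp cardS iS yS iy (D_dep x xA) (D_supp x xS) Dxi Dxy x.
  by move/eqP; rewrite Dxx oner_eq0.
(* [C] exceeds all the ratios at which [D y + C * D x] would acquire a zero. *)
pose C := 1 + \sum_(i in A) `|D y i / D x i|.
have C_gt0 : 0 < C by rewrite ltr_pwDl // sumr_ge0.
pose w i := 1 * D y i + C * D x i.
have w_dep : affine_dependence p w by apply: affine_dependence_lin; apply: D_dep.
have w_supp i : i \notin S -> w i = 0 by move=> iS; rewrite /w !D_supp // !mulr0 addr0.
have w_neq0 : {in S, forall i, w i != 0}.
  move=> i iS; have [->|ix] := eqVneq i x.
    by rewrite /w Dyx Dxx mulr0 add0r mulr1 gt_eqF.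
  have [->|iy] := eqVneq i y.
    by rewrite /w Dyy Dxy mulr0 addr0 mulr1 oner_eq0.
  have iA : i \in A by rewrite !finset.inE ix iy.
  apply/eqP; rewrite /w mul1r => w0.
  have : `|D y i / D x i| = C.
    have -> : D y i = - C * D x i by lra.
    by rewrite mulfK ?Dx_neq0 // normrN gtr0_norm.
  apply/eqP; rewrite lt_eqF // /C (bigD1 i) //= addrA ltr_wpDr ?sumr_ge0 //.
  by rewrite ltrDr.
exists (D x), w; split=> //.
- by split=> //; apply: D_dep.
- by move=> i iS; rewrite D_supp ?w_supp.
- move=> i j iS jS ratio_eq; apply/eqP/negP => /negP ij.
  pose r := D x i / w i.
  have l_dep : affine_dependence p (fun k => 1 * D x k + (- r) * w k).
    by apply: affine_dependence_lin => //; apply: D_dep.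
  have l_supp k : k \notin S -> 1 * D x k + (- r) * w k = 0.
    by move=> kS; rewrite D_supp ?w_supp // !mulr0 addr0.
  have li : 1 * D x i + (- r) * w i = 0.
    by rewrite /r mulNr divfK ?w_neq0 // mul1r subrr.
  have lj : 1 * D x j + (- r) * w j = 0.
    by rewrite /r ratio_eq mulNr divfK ?w_neq0 // mul1r subrr.
  have l0 := dependence_two_zeros gp cardS iS jS ij l_dep l_supp li lj.
  have := l0 y; rewrite {1}/w Dxy Dyy => r0.
  have := l0 x; rewrite {1}/w Dxx Dyx => r1.
  have r_eq0 : r = 0 by lra.
  by move: r1; rewrite r_eq0; lra.
move=> l l_dep l_supp; exists (l x - C * l y), (l y) => i.
pose m k := 1 * (1 * l k + (- l x) * D x k) + (- l y) * D y k.
suff m0 : m i = 0 by rewrite /w; move: m0; rewrite /m; lra.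
apply: two_zeros.
- by do !apply: affine_dependence_lin => //; apply: D_dep.
- by move=> k kS; rewrite /m l_supp ?D_supp // !mulr0 !addr0 mulr0.
- by rewrite /m Dxx Dyx; lra.
- by rewrite /m Dxy Dyy; lra.
Qed.

(** If [l] were positive at most at [v], take a linear functional maximal over the
    points at [v] only, and let [h i] be the amount by which its value at [v]
    exceeds the one at [i]. The dependence gives a zero sum of the [l i * h i],
    none of which is positive; so [l] vanishes off [v], and then at [v]. *)
Lemma dependence_two_positive (R : realType) (T : finType) (p : T -> 'rV[R]_3)
    (l : T -> R) (j : T) :
    injective p -> convex_position p -> affine_dependence p l -> l j != 0 ->
  (2 <= #|[set i | (0 < l i)%R]%SET|)%N.
Proof.
move=> p_inj p_conv l_dep lj; rewrite ltnNge; apply/negP => card_le1.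
have [v l_le0] : exists v, forall i, i != v -> l i <= 0.
  have [S0|/finset.set0Pn[v vS]] := eqVneq [set i | 0 < l i]%SET finset.set0.
    exists j => i _; rewrite leNgt; apply/negP => li.
    by have := finset.in_set0 i; rewrite -S0 finset.inE li.
  exists v => i; apply: contraNT; rewrite -ltNge => li; apply/eqP.
  by apply: (card_le1_eqP card_le1) => //; rewrite finset.inE.
have [_ [a a_max]] := p_conv v.
pose h i := dot a (p v) - dot a (p i).
have h_gt0 i : i != v -> 0 < h i.
  move=> iv; rewrite subr_gt0; apply: a_max; last by rewrite (inj_eq p_inj).
  by move=> C [_]; apply; exists i.
have /eqP : \sum_i - l i * h i = 0.
  pose c := col_mx (- a)^T (const_mx (dot a (p v))) : 'cV[R]_(3 + 1).
  transitivity (- \sum_i l i * affine_form c (p i)); last first.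
    by rewrite affine_dependence_form // oppr0.
  rewrite -sumrN; apply: eq_bigr => i _.
  rewrite affine_formE col_mxKu col_mxKd trmxK mxE mulNr /h; congr (- (_ * _)).
  rewrite addrC; congr (_ + _); rewrite -sumrN; apply: eq_bigr => k _.
  by rewrite mxE mulNr.
rewrite psumr_eq0 => [/allP all0|i _].
  have l0 i : i != v -> l i = 0.
    move=> iv; have := all0 i (mem_index_enum i); rewrite implyTb mulf_eq0.
    by rewrite (gt_eqF (h_gt0 i iv)) orbF oppr_eq0 => /eqP.
  have lv : l v = 0.
    move: l_dep; rewrite /affine_dependence (bigD1 v) //= big1 => [|i /l0 ->].
      rewrite addr0 /homog scale_row_mx => /matrixP/(_ 0 (rshift 3 0)).
      by rewrite row_mxEr !mxE mulr1.
    by rewrite scale0r.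
  by case/eqP: lj; case: (eqVneq j v) => [->//|/l0].
have [->|iv] := eqVneq i v; first by rewrite /h subrr mulr0.
by rewrite mulr_ge0 ?oppr_ge0 ?l_le0 // ltW ?h_gt0.
Qed.

(** * Counting crossings *)

Lemma cover_pair (T : finType) (e f : {set T}) : finset.cover [set e; f]%SET = (e :|: f)%SET.
Proof.
apply/setP => x; rewrite finset.in_setU; apply/bigcupP/orP.
  by case=> A; rewrite finset.in_set2 => /orP[] /eqP ->; [left|right].
by case=> hx; [exists e | exists f] => //; rewrite finset.in_set2 eqxx ?orbT.
Qed.

Lemma mem_crossing_pairs (R : realType) (T : finType) (H : hypergraph3 T)
    (p : T -> 'rV[R]_3) (P : {set {set T}}) :
  P \in crossing_pairs H p <-> exists e f, [/\ e \in hyperedges H,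
    f \in hyperedges H, P = [set e; f]%SET & crosses p e f].
Proof.
rewrite finset.inE; split.
  move=> /existsP[e /andP[eH /existsP[f /and3P[fH /eqP PE /asboolP cr]]]].
  by exists e, f.
move=> [e [f [eH fH PE cr]]]; apply/existsP; exists e; rewrite eH /=.
by apply/existsP; exists f; rewrite fH PE eqxx /=; apply/asboolP.
Qed.

(** The six stages of the pencil of dependences on [S] list the splits of [S] by
    sign vectors once each; the crossing pairs are the stages with three
    positive points. *)
Lemma six_point_crossings (R : realType) (n : nat) (p : 'I_n -> 'rV[R]_3)
    (S : {set 'I_n}) : convex_drawing p -> #|S| = 6%N ->
  #|[set P in crossing_pairs (complete3 n) p | finset.cover P == S]%SET| = 3%N.
Proof.
move=> [p_inj gp p_conv] cardS.
have [u [w [[u_dep w_dep] uw_supp w_neq0 ratio_inj span]]] := dependence_pencil gp cardS.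
have [q def_S mono] := sorted_enumeration ratio_inj cardS.
have q_inj : injective q.
  have /imset_injP q_inj : #|[set q i | i in 'I_6]%SET| == #|'I_6|.
    by rewrite -def_S cardS card_ord.
  by move=> i j; apply: q_inj.
have qS i : q i \in S by rewrite def_S imset_f.
have wq_neq0 i : w (q i) != 0 by apply: w_neq0.
pose P k := flip_prefix (fun i => 0 < w (q i)) k.
have qC (A : {set 'I_6}) : q @: (~: A) = S :\: q @: A.
  apply/setP => x; rewrite finset.in_setD; apply/imsetP/andP => [[i iA ->]|[xA]].
    by rewrite mem_imset // qS -finset.in_setC.
  rewrite {1}def_S => /imsetP[i _ xi]; exists i => //.
  by move: xA; rewrite xi mem_imset // finset.in_setC.
have realise (k : 'I_6) : exists l, [/\ affine_dependence p l,
    forall i, i \notin S -> l i = 0, {in q @: P k, forall i, 0 < l i} &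
    {in q @: (~: P k), forall i, l i < 0}].
  have [r r_sign] := pencil_realises k wq_neq0 mono.
  exists (fun i => 1 * u i + (- r) * w i); split.
  - exact: affine_dependence_lin.
  - by move=> i /uw_supp[-> ->]; rewrite !mulr0 addr0.
  - move=> _ /imsetP[i + ->]; have [_ ->] := r_sign i; lra.
  - move=> _ /imsetP[i + ->]; have [neq0 E] := r_sign i.
    rewrite finset.in_setC E -leNgt => le0.
    by rewrite mul1r mulNr lt_neqAle neq0.
have bounds (k : 'I_6) : (2 <= #|P k| <= 4)%N.
  have [l [l_dep l_supp l_pos l_neg]] := realise k.
  have [j lj] : exists j, l j != 0.
    exists (q ord0); have [kP|kP] := boolP (ord0 \in P k).
      by rewrite gt_eqF ?l_pos ?imset_f.
    by rewrite lt_eqF ?l_neg ?imset_f ?finset.in_setC.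
  have posE A B (m : 'I_n -> R) : B = ~: A -> (forall i, i \notin S -> m i = 0) ->
      {in q @: A, forall i, 0 < m i} -> {in q @: B, forall i, m i < 0} ->
      [set i | 0 < m i]%SET = q @: A.
    move=> -> m_supp m_pos m_neg; apply/setP => i; rewrite finset.inE.
    apply/idP/idP => [mi|/m_pos//].
    have iS : i \in S by apply: contraTT mi => /m_supp ->; rewrite ltxx.
    apply: contraTT mi => iA; rewrite -leNgt ltW // m_neg //.
    by rewrite qC finset.in_setD iA.
  have := dependence_two_positive p_inj p_conv l_dep lj.
  rewrite (posE (P k) (~: P k)) // card_imset // => -> /=.
  have Nl_dep : affine_dependence p (fun i => (-1) * l i + 0 * l i).
    exact: affine_dependence_lin.
  have := dependence_two_positive (j := j) p_inj p_conv Nl_dep.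
  rewrite (posE (~: P k) (P k)) ?finset.setCK //.
  - rewrite card_imset // => two.
    have card_sum : (#|P k| + #|~: P k|)%N = 6%N by rewrite cardsC card_ord.
    rewrite -(leq_add2r #|~: P k|) card_sum (leq_add2l 4 2); apply: two.
    by rewrite mulN1r mul0r addr0 oppr_eq0.
  - by move=> i /l_supp ->; lra.
  - by move=> i /l_neg; lra.
  - by move=> i /l_pos; lra.
have qT (A : {set 'I_6}) : (q @: A :|: q @: (~: A))%SET = S.
  apply/setP => x; rewrite qC finset.in_setU finset.in_setD.
  by have [/imsetP[i _ ->]|] //= := boolP (x \in q @: A); rewrite qS.
pose K := [set k : 'I_6 | #|P k| == 3%N]%SET.
pose pair (A : {set 'I_6}) : {set {set 'I_n}} := [set q @: A; q @: (~: A)]%SET.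
have -> : [set Q in crossing_pairs (complete3 n) p | finset.cover Q == S]%SET =
    [set pair (P k) | k : 'I_6 in K]%SET.
  apply/setP => Q; rewrite finset.in_set; apply/idP/imsetP; last first.
    move=> [k kK ->]; move: kK; rewrite finset.inE => /eqP Pk3.
    rewrite cover_pair qT eqxx andbT.
    have card_e : #|q @: P k| = 3%N by rewrite card_imset.
    have card_f : #|q @: (~: P k)| = 3%N.
      rewrite card_imset //; have := cardsC (P k); rewrite Pk3 card_ord.
      by move=> /(@addnI 3 _ 3).
    apply/mem_crossing_pairs; exists (q @: P k), (q @: (~: P k)); split => //.
    - by rewrite finset.inE card_e.
    - by rewrite finset.inE card_f.
    apply/(crossesP gp card_e card_f); split.
      by rewrite qC disjoint_sym finset.disjoints_subset finset.setDE finset.subsetIr.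
    have [l [l_dep l_supp l_pos l_neg]] := realise k.
    by exists l; split => //; rewrite qT.
  move=> /andP[/mem_crossing_pairs[e [f [eH fH -> cr]]]].
  rewrite cover_pair => /eqP ef_S.
  have card_e := hyperedges_uniform eH; have card_f := hyperedges_uniform fH.
  move/(crossesP gp card_e card_f) : cr => [dis [l [l_dep l_pos l_neg l_supp]]].
  rewrite ef_S in l_supp.
  have [a [b lE]] := span l l_dep l_supp.
  have ef i : i \in S -> (i \in f) = (i \notin e).
    rewrite -ef_S finset.in_setU => /orP[ie|i_f].
      by rewrite ie (disjointFr dis ie).
    by rewrite i_f (disjointFl dis i_f).
  have neq0 i : a * u (q i) + b * w (q i) != 0.
    rewrite -lE; have [ie|ie] := boolP (q i \in e); first by rewrite gt_eqF ?l_pos.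
    by rewrite lt_eqF ?l_neg // ef.
  have [k pos_k] := pencil_sign_vectors (isT : (0 < 6)%N) wq_neq0 mono neq0.
  set pos := [set i | _]%SET in pos_k.
  have eE : e = q @: pos.
    apply/setP => i; apply/idP/imsetP => [ie|[j + ->]].
      have : i \in S by rewrite -ef_S finset.in_setU ie.
      rewrite def_S => /imsetP[j _ ij]; exists j => //.
      by rewrite finset.inE -lE -ij l_pos.
    rewrite finset.inE -lE; apply: contraTT => je.
    by rewrite -leNgt ltW // l_neg // ef.
  have fE : f = q @: (~: pos).
    rewrite qC -eE -ef_S finset.setDUl finset.setDv finset.set0U.
    by apply/esym/finset.setDidPl; rewrite disjoint_sym.
  have pairE : [set e; f]%SET = pair (P k).
    rewrite eE fE; case: pos_k => -> //.
    by rewrite finset.setCK finset.setUC.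
  exists k => //; rewrite finset.inE; move: card_e card_f; rewrite eE fE.
  by rewrite !card_imset //; case: pos_k => ->; rewrite ?finset.setCK => c1 c2;
    apply/eqP.
rewrite card_in_imset; first exact: halving_stages.
move=> k l _ _ /setP/(_ (q @: P k)); rewrite finset.in_set2 eqxx finset.in_set2.
move=> /esym/orP[] /eqP /(imset_inj q_inj) eqP_kl;
  apply: (@flip_prefix_inj _ (fun i => 0 < w (q i))); [left|right];
  exact: eqP_kl.
Qed.

(** A crossing pair is counted at the six-point set that it covers. *)
Lemma card_crossing_pairs (R : realType) (n : nat) (p : 'I_n -> 'rV[R]_3) :
  convex_drawing p -> #|crossing_pairs (complete3 n) p| = (3 * 'C(n, 6))%N.
Proof.
move=> p_draw; pose S6 := [set S : {set 'I_n} | #|S| == 6%N]%SET.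
have cardS6 : #|S6| = 'C(n, 6).
  rewrite -[in RHS](card_ord n) -cardsT -cards_draws; apply: eq_card => S.
  by rewrite !finset.inE finset.subsetT.
rewrite -sum1_card (partition_big finset.cover [in S6]) /=; last first.
  move=> Q /mem_crossing_pairs[e [f [eH fH -> [dis _]]]].
  rewrite cover_pair finset.inE cardsU (hyperedges_uniform eH) (hyperedges_uniform fH).
  by move: dis; rewrite -finset.setI_eq0 => /eqP ->; rewrite cards0.
rewrite (eq_bigr (fun=> 3%N)) => [|S].
  by rewrite sum_nat_const cardS6 mulnC.
rewrite finset.inE => /eqP cardS; rewrite -(six_point_crossings p_draw cardS).
by rewrite -sum1_card; apply: eq_bigl => Q; rewrite [in RHS]finset.inE.
Qed.

(** * The moment curve *)

Definition moment_curve (R : realType) (t : R) : 'rV[R]_3 :=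
  \row_(j < 3) t ^+ j.+1.

(** The parameters are four roots of a polynomial of degree at most 3. *)
Lemma moment_curve_coplanar (R : realType) (a : 'rV[R]_3) (b : R) (s : seq R) :
    uniq s -> size s = 4%N -> {in s, forall t, dot a (moment_curve t) = b} ->
  a = 0.
Proof.
move=> s_uniq size_s s_plane.
pose q := \poly_(i < 4) (if i is j.+1 then a 0 (inord j) else - b).
have q_root : all (root q) s.
  apply/allP => t ts; rewrite /root horner_poly big_ord_recl expr0 mulr1.
  rewrite addrC -(s_plane t ts) subr_eq0; apply/eqP; apply: eq_bigr => j _.
  by rewrite /= !mxE inord_val.
have q0 : q = 0.
  apply/eqP/negP => /negP q_neq0.
  have := max_poly_roots q_neq0 q_root s_uniq.
  by rewrite size_s ltnNge size_poly.
apply/rowP => j; rewrite mxE.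
have := coef_poly 4 (fun i => if i is j.+1 then a 0 (inord j) else - b) j.+1.
by rewrite -/q q0 coef0 ltnS ltn_ord inord_val => <-.
Qed.

(** The functional, up to a constant, is minus the square of the distance between
    the parameters; its maximum exposes the point of parameter [t]. *)
Lemma moment_curve_support (R : realType) (t : R) :
  exists a, forall s, dot a (moment_curve s) = t ^+ 2 - (s - t) ^+ 2.
Proof.
exists (\row_j [:: t *+ 2; -1; 0]`_j) => s.
rewrite /dot !big_ord_recr big_ord0 /= !mxE /= mul0r addr0 add0r mulN1r.
by ring.
Qed.

Lemma convex_drawing_moment_curve (R : realType) (n : nat) :
  convex_drawing (fun i : 'I_n => moment_curve (i%:R : R)).
Proof.
have mul_inj : injective (fun i : 'I_n => i%:R : R).
  by move=> i j /eqP; rewrite eqr_nat => /eqP/ord_inj.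
split.
- move=> i j /rowP/(_ 0); rewrite !mxE !expr1; exact: mul_inj.
- move=> A cardA [_ [a [b [/eqP a_neq0 ->]]] A_plane]; apply: a_neq0.
  apply: (@moment_curve_coplanar _ _ b [seq (i : 'I_n)%:R | i <- enum A]).
  + by rewrite map_inj_uniq ?enum_uniq.
  + by rewrite size_map -cardE.
  by move=> _ /mapP[i + ->]; rewrite mem_enum => /A_plane.
move=> v; split; first by move=> C [_]; apply; exists v.
pose t : R := v%:R; have [a aE] := moment_curve_support t.
have dot_comb r x y : dot a (r *: x + (1 - r) *: y) = r * dot a x + (1 - r) * dot a y.
  rewrite /dot !mulr_sumr -big_split; apply: eq_bigr => j _.
  by rewrite !mxE /=; ring.
exists a => y y_hull; suff : y = moment_curve t \/ dot a y < dot a (moment_curve t).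
  by case=> // ->; rewrite eqxx.
pose C := [set z | z = moment_curve t \/ dot a z < dot a (moment_curve t)]%classic.
apply: (y_hull C); split.
  apply/convex_setP => r x z /andP[r0 r1] Cx Cz; rewrite /C /=.
  have [->|r_neq0] := eqVneq r 0; first by rewrite scale0r add0r subr0 scale1r.
  have [->|r_neq1] := eqVneq r 1; first by rewrite subrr scale0r addr0 scale1r.
  have r_gt0 : 0 < r by rewrite lt_neqAle eq_sym r_neq0.
  have r_lt1 : r < 1 by rewrite lt_neqAle r_neq1.
  rewrite dot_comb; move: Cx Cz => [->|x_lt] [->|z_lt].
  - by left; rewrite -scalerDl addrC subrK scale1r.
  - by right; nra.
  - by right; nra.
  - by right; nra.
move=> _ [i _ <-]; rewrite /C /= !aE subrr expr0n subr0.
have [->|iv] := eqVneq i v; first by left.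
right; rewrite ltrBlDr ltrDl exprn_even_gt0 //= subr_eq0.
by rewrite eqr_nat; apply: contra_neq iv => /ord_inj.
Qed.

Theorem corollary3 (R : realType) (n : nat) (hn : (6 <= n)%N) :
  convex_crossing_number3 R (complete3 n) = (3 * 'C(n, 6))%N.
Proof.
apply: xget_unique => [|k [[p p_draw <-] _]]; last exact: card_crossing_pairs.
split; last by move=> j [p p_draw <-]; rewrite card_crossing_pairs.
exists (fun i : 'I_n => moment_curve (i%:R : R)); first exact: convex_drawing_moment_curve.
exact/card_crossing_pairs/convex_drawing_moment_curve.
Qed.
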